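(* The solution of the nonlinear second order differential equation $$u_{tt}+a u_{xt}+b(u)u_t(u_t+a u_x)=\alpha(x,t)e^{-\int b(u)\,du}+G(u)(u_t+a u_x)$$ is obtained by solving $$u_t=(H(t)+K(u))\,e^{-\int b(u)\,du},$$ where the functions $H$ and $K$ are the general solutions of $$H'(t)=\alpha(x(t),t)\qquad\text{and}\qquad K'(u)=G(u)\,e^{\int b(u)\,du}.$$
   Context: Here $u$ is the unknown function of $(x,t)$, and $a=a(x,t)$, $\alpha(x,t)$, $b(u)$ and $G(u)$ are given functions. The function $x(t)$ is the solution of $\frac{dx(t)}{dt}=a(x(t),t)$, $x(0)=x_0$. The first order equation for $u_t$ is the form that $u_t$ is supposed to have in order to solve the second order equation, which after multiplication by $e^{\int b(u)\,du}$ reads, along $x(t)$, $\frac{d}{dt}\big[u_t(x(t),t)e^{\int b(u)\,du}\big]=\alpha(x,t)+G(u)(u_t+a u_x)e^{\int b(u)\,du}$. *)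

(* Defs.v *)
From Stdlib Require Import Reals.
From Coquelicot Require Import Coquelicot.
Open Scope R_scope.

Definition open_itv (l r : Rbar) (s : R) : Prop := Rbar_lt l s /\ Rbar_lt s r.

Definition Dx (u : R -> R -> R) (x t : R) : R := Derive (fun y => u y t) x.
Definition Dt (u : R -> R -> R) (x t : R) : R := Derive (fun s => u x s) t.

(* [ex_diff_n u 2 x t] asks that u and its partial derivatives of order at
   most 2 exist and are jointly continuous at (x, t). *)
Definition C2_on (U : R * R -> Prop) (u : R -> R -> R) : Prop :=
  forall x t, U (x, t) -> ex_diff_n u 2 x t.

(* The indefinite integral of f: a choice of the integration constant is a
   choice of F. *)
Definition antiderivative_on (J : R -> Prop) (f F : R -> R) : Prop :=
  forall s, J s -> is_derive F s (f s).

Definition characteristic (a : R -> R -> R) (x0 : R) (I : R -> Prop)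
    (x : R -> R) : Prop :=
  x 0 = x0 /\ forall t, I t -> is_derive x t (a (x t) t).

(* B stands for the indefinite integral of b. *)
Definition second_order_eq (a alpha : R -> R -> R) (b B G : R -> R)
    (u : R -> R -> R) (x t : R) : Prop :=
  Dt (Dt u) x t + a x t * Dt (Dx u) x t
    + b (u x t) * Dt u x t * (Dt u x t + a x t * Dx u x t)
  = alpha x t * exp (- B (u x t))
    + G (u x t) * (Dt u x t + a x t * Dx u x t).

Definition first_order_eq (B H K : R -> R) (u : R -> R -> R) (x t : R) : Prop :=
  Dt u x t = (H t + K (u x t)) * exp (- B (u x t)).

(* Main.v *)
Require Import Defs.
From Stdlib Require Import Reals Lra Classical.
From Coquelicot Require Import Coquelicot.
Open Scope R_scope.

(** Along a characteristic x(t), the operator d/dt is d_t + a d_x, so that the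
    second order equation, multiplied by exp (B u), is an exact derivative.
    If K' = G exp B, then for
      W(t) = u_t exp (B u) - K(u)   at (x(t), t)
    the chain rule gives
      W' = exp (B u) (u_tt + a u_xt + b u_t (u_t + a u_x) - G (u_t + a u_x)),
    where u_xt may be read in either order by the theorem of Schwarz. Hence the
    second order equation at (x(t), t) says exactly that W'(t) = alpha(x(t), t)
    ([second_order_eq_iff_is_derive]), while the first order equation says
    exactly that W(t) = H(t) ([first_order_eq_iff]). So a solution of the second
    order equation provides H as the function W itself, for any choice of K;
    such a K exists because G exp B is continuous on an interval
    ([continuous_has_antiderivative]). Conversely, if W coincides with some H on
    the interval of times, and H' = alpha, then W' = alpha there. *)

(** * Antiderivatives on an open interval *)

Lemma open_itv_locally (l r : Rbar) (s : R) :
  open_itv l r s -> locally s (open_itv l r).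
Proof.
intros [H1 H2].
now apply filter_and; [apply open_Rbar_gt | apply open_Rbar_lt].
Qed.

Lemma open_itv_between (l r : Rbar) (p q s : R) :
  open_itv l r p -> open_itv l r q -> Rmin p q <= s <= Rmax p q ->
  open_itv l r s.
Proof.
intros [Hlp Hpr] [Hlq Hqr] [Hs1 Hs2]; split.
- apply Rbar_lt_le_trans with (Finite (Rmin p q)); [| exact Hs1].
  now apply Rmin_case.
- apply Rbar_le_lt_trans with (Finite (Rmax p q)); [exact Hs2 |].
  now apply Rmax_case.
Qed.

Lemma continuous_has_antiderivative (l r : Rbar) (f : R -> R) :
  (forall s, open_itv l r s -> continuous f s) ->
  exists F, antiderivative_on (open_itv l r) f F.
Proof.
intros Hf.
(* The base point of the integral has to be taken inside the interval, which
   may be empty. *)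
destruct (classic (exists s0, open_itv l r s0)) as [[s0 Hs0] | Hempty].
- exists (fun s => RInt f s0 s); intros s Hs.
  apply (is_derive_RInt f (fun s => RInt f s0 s) s0); [| now apply Hf].
  apply filter_imp with (2 := open_itv_locally l r s Hs); intros s' Hs'.
  apply (RInt_correct f), (ex_RInt_continuous f).
  intros z Hz; apply Hf; now apply (open_itv_between l r s0 s').
- exists f; intros s Hs; exfalso; apply Hempty; now exists s.
Qed.

(** * Differentiation along a curve *)

Lemma C2_on_locally (U : R * R -> Prop) (u : R -> R -> R) (x t : R) :
  open U -> C2_on U u -> U (x, t) -> locally_2d (ex_diff_n u 2) x t.
Proof.
intros HU Hu Hxt; apply locally_2d_locally.
apply (locally_open U); [exact HU | | exact Hxt].
intros [y s] Hys; exact (Hu y s Hys).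
Qed.

(** Partial derivatives alone would not give the chain rule: their continuity
    makes f differentiable as a function of two variables. *)
Lemma is_derive_along_curve (f : R -> R -> R) (x : R -> R) (t v : R) :
  locally_2d (ex_diff_n f 1) (x t) t -> is_derive x t v ->
  is_derive (fun s => f (x s) s) t (Dt f (x t) t + v * Defs.Dx f (x t) t).
Proof.
intros Hf Hx.
assert (Hd : differentiable_pt_lim f (x t) t
               (Defs.Dx f (x t) t) (Dt f (x t) t)).
{ apply filterdiff_differentiable_pt_lim.
  apply (is_derive_filterdiff f (x t) t (Defs.Dx f)).
  - apply (locally_2d_locally
      (fun y s => is_derive (fun z => f z s) y (Defs.Dx f y s))).
    apply locally_2d_impl with (2 := Hf), locally_2d_forall.
    intros y s [_ [Hy _]]; now apply Derive_correct.
  - apply locally_2d_singleton in Hf as [_ [_ [Ht _]]].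
    now apply Derive_correct.
  - apply locally_2d_singleton in Hf as [_ [_ [_ [[Hc _] _]]]].
    now apply continuity_2d_pt_filterlim in Hc. }
apply is_derive_Reals.
replace (Dt f (x t) t + v * Defs.Dx f (x t) t)
  with (Defs.Dx f (x t) t * v + Dt f (x t) t * 1) by ring.
apply (derivable_pt_lim_comp_2d f x (fun s => s)); [exact Hd | |].
- now apply is_derive_Reals.
- apply derivable_pt_lim_id.
Qed.

Lemma Dx_Dt_comm (u : R -> R -> R) (x t : R) :
  locally_2d (ex_diff_n u 2) x t -> Defs.Dx (Dt u) x t = Dt (Defs.Dx u) x t.
Proof.
intros Hu; apply Schwarz.
- apply locally_2d_impl with (2 := Hu), locally_2d_forall.
  intros y s [_ [Hx [Ht [[_ [_ [Hxt _]]] [_ [Htx _]]]]]].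
  now repeat split.
- now apply locally_2d_singleton in Hu as [_ [_ [_ [_ [_ [_ [_ [[H _] _]]]]]]]].
- now apply locally_2d_singleton in Hu as [_ [_ [_ [[_ [_ [_ [_ [H _]]]]] _]]]].
Qed.

(** * The first integral *)

(** The value that H must take at time t for the first order equation to hold
    at (x(t), t). *)
Definition first_integral (B K : R -> R) (u : R -> R -> R) (x : R -> R)
    (t : R) : R :=
  Dt u (x t) t * exp (B (u (x t) t)) - K (u (x t) t).

Lemma first_order_eq_iff (B H K : R -> R) (u : R -> R -> R) (x : R -> R)
    (t : R) :
  first_order_eq B H K u (x t) t <-> first_integral B K u x t = H t.
Proof.
unfold first_order_eq, first_integral; rewrite exp_Ropp.
assert (Hpos := exp_pos (B (u (x t) t))); split; intros E.
- rewrite E; field; lra.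
- rewrite <- E; field; lra.
Qed.

(** The exponential is an integrating factor: it turns the terms
    u_tt + a u_xt + b u_t (u_t + a u_x) into the derivative of
    u_t exp (B u) along the curve. *)
Lemma is_derive_first_integral (a : R -> R -> R) (b B G K : R -> R)
    (u : R -> R -> R) (x : R -> R) (t : R) :
  locally_2d (ex_diff_n u 2) (x t) t ->
  is_derive x t (a (x t) t) ->
  is_derive B (u (x t) t) (b (u (x t) t)) ->
  is_derive K (u (x t) t) (G (u (x t) t) * exp (B (u (x t) t))) ->
  is_derive (first_integral B K u x) t
    (exp (B (u (x t) t)) *
      (Dt (Dt u) (x t) t + a (x t) t * Dt (Defs.Dx u) (x t) t
       + b (u (x t) t) * Dt u (x t) t
           * (Dt u (x t) t + a (x t) t * Defs.Dx u (x t) t)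
       - G (u (x t) t) * (Dt u (x t) t + a (x t) t * Defs.Dx u (x t) t))).
Proof.
intros Hu Hx HB HK.
assert (Hu1 : locally_2d (ex_diff_n u 1) (x t) t).
{ apply locally_2d_impl with (2 := Hu), locally_2d_forall; intros y s.
  apply ex_diff_n_m; auto. }
assert (Hut : locally_2d (ex_diff_n (Dt u) 1) (x t) t).
{ apply locally_2d_impl with (2 := Hu), locally_2d_forall; intros y s.
  apply ex_diff_n_deriv_aux2. }
assert (Du := is_derive_along_curve u x t _ Hu1 Hx).
assert (Dut := is_derive_along_curve (Dt u) x t _ Hut Hx).
rewrite (Dx_Dt_comm u (x t) t Hu) in Dut.
assert (DB := is_derive_comp B (fun s => u (x s) s) t _ _ HB Du).
assert (DK := is_derive_comp K (fun s => u (x s) s) t _ _ HK Du).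
assert (DE := is_derive_comp exp (fun s => B (u (x s) s)) t _ _
                (is_derive_exp _) DB).
assert (DM := is_derive_mult _ _ t _ _ Dut DE Rmult_comm).
assert (DW := is_derive_minus _ _ t _ _ DM DK).
refine (eq_ind _ (is_derive (first_integral B K u x) t) DW _ _).
unfold minus, plus, opp, scal, mult; simpl; unfold mult; simpl; ring.
Qed.

Lemma second_order_eq_iff_is_derive (a alpha : R -> R -> R) (b B G K : R -> R)
    (u : R -> R -> R) (x : R -> R) (t : R) :
  locally_2d (ex_diff_n u 2) (x t) t ->
  is_derive x t (a (x t) t) ->
  is_derive B (u (x t) t) (b (u (x t) t)) ->
  is_derive K (u (x t) t) (G (u (x t) t) * exp (B (u (x t) t))) ->
  second_order_eq a alpha b B G u (x t) t <->
  is_derive (first_integral B K u x) t (alpha (x t) t).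
Proof.
intros Hu Hx HB HK.
assert (DW := is_derive_first_integral a b B G K u x t Hu Hx HB HK).
unfold second_order_eq; rewrite exp_Ropp.
assert (Hpos := exp_pos (B (u (x t) t))); split; intros E.
- rewrite E in DW.
  refine (@eq_ind R _ (is_derive (first_integral B K u x) t) DW _ _).
  field; lra.
- apply is_derive_unique in E; apply is_derive_unique in DW.
  rewrite DW in E; rewrite <- E; field; lra.
Qed.

(** * Solutions along the characteristics *)

Theorem proposition5
  (a alpha : R -> R -> R) (b B G : R -> R)
  (* interval of values of u, on which b and G are given *)
  (vmin vmax : Rbar)
  (HB : antiderivative_on (open_itv vmin vmax) b B)
  (HG : forall v, open_itv vmin vmax v -> continuous G v)
  (* the unknown, on an open set of (x, t) *)
  (U : R * R -> Prop) (HU : open U)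
  (u : R -> R -> R) (Hu : C2_on U u)
  (Hval : forall x t, U (x, t) -> open_itv vmin vmax (u x t))
  (* the characteristics X x0, issued from the points x0 of S at time 0 *)
  (S : R -> Prop) (tmin tmax : R -> Rbar) (X : R -> R -> R)
  (Htime : forall x0, S x0 -> open_itv (tmin x0) (tmax x0) 0)
  (HX : forall x0, S x0 ->
     characteristic a x0 (open_itv (tmin x0) (tmax x0)) (X x0))
  (HXU : forall x0 t, S x0 -> open_itv (tmin x0) (tmax x0) t ->
     U (X x0 t, t)) :
  (forall x t,
     (exists x0, S x0 /\ open_itv (tmin x0) (tmax x0) t /\ x = X x0 t) ->
     second_order_eq a alpha b B G u x t)
  <->
  (exists (H : R -> R -> R) (K : R -> R),
     (forall x0, S x0 ->
        antiderivative_on (open_itv (tmin x0) (tmax x0))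
          (fun t => alpha (X x0 t) t) (H x0)) /\
     antiderivative_on (open_itv vmin vmax) (fun v => G v * exp (B v)) K /\
     (forall x0 t, S x0 -> open_itv (tmin x0) (tmax x0) t ->
        first_order_eq B (H x0) K u (X x0 t) t)).
Proof.
assert (Heq : forall K,
  antiderivative_on (open_itv vmin vmax) (fun v => G v * exp (B v)) K ->
  forall x0 t, S x0 -> open_itv (tmin x0) (tmax x0) t ->
  second_order_eq a alpha b B G u (X x0 t) t <->
  is_derive (first_integral B K u (X x0)) t (alpha (X x0 t) t)).
{ intros K HK x0 t Hx0 Ht.
  assert (HUt := HXU x0 t Hx0 Ht); assert (Hv := Hval _ _ HUt).
  apply second_order_eq_iff_is_derive.
  - now apply (C2_on_locally U).
  - now apply (HX x0 Hx0).
  - now apply HB.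
  - now apply HK. }
split.
- intros Hsol.
  destruct (continuous_has_antiderivative vmin vmax (fun v => G v * exp (B v)))
    as [K HK].
  { intros v Hv; apply (continuous_mult G (fun v => exp (B v))).
    - now apply HG.
    - apply (continuous_comp B exp).
      + apply (ex_derive_continuous B); exists (b v); now apply HB.
      + apply (ex_derive_continuous exp); exists (exp (B v)).
        apply is_derive_exp. }
  exists (fun x0 => first_integral B K u (X x0)), K; split; [| split].
  + intros x0 Hx0 t Ht; apply (Heq K HK x0 t Hx0 Ht), Hsol.
    now exists x0.
  + exact HK.
  + intros x0 t Hx0 Ht; now apply first_order_eq_iff.
- intros [H [K [HH [HK H1]]]] x t [x0 [Hx0 [Ht ->]]].
  apply (Heq K HK x0 t Hx0 Ht).
  (* The first order equation holds at all times close to t, so that the first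
     integral and H x0 have the same derivative at t. *)
  apply (is_derive_ext_loc (H x0)); [| exact (HH x0 Hx0 t Ht)].
  apply filter_imp with (2 := open_itv_locally _ _ t Ht); intros s Hs.
  symmetry; apply first_order_eq_iff; now apply H1.
Qed.
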